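(* Let $B$ be a finite Blaschke product of degree $2^n$ and let $g$ be a generator of its group of invariants $\mathcal{G}_B$. Suppose $B=C_n\circ C_{n-1}\circ\cdots\circ C_1$ where each $C_j$ is a Blaschke product of degree $2$. Then for each $j=1,\dots,n-1$, the group of invariants of $C_j\circ\cdots\circ C_1$ is a normal subgroup of index $2$ of the group of invariants of $C_{j+1}\circ C_j\circ\cdots\circ C_1$. Moreover, if $C_1(z)=z\left(\frac{a-z}{1-\overline{a}z}\right)$ with $a\in\mathbb{D}$, then $g^{2^{n-1}}=\varphi_a$, where $\varphi_a(z)=\frac{a-z}{1-\overline{a}z}$.
   Context: A finite Blaschke product of degree $d$ is $B(z)=\gamma\prod_{j=1}^d \frac{z-a_j}{1-\overline{a_j}z}$ with $a_j\in\mathbb{D}$ and $|\gamma|=1$. For a finite Blaschke product $F$, its group of invariants is $\mathcal{G}_F=\{u:\mathbb{T}\to\mathbb{T}\ \text{continuous} : F\circ u=F\}$, a group under composition (powers $g^m$ denote $m$-fold composition); functions in $\mathcal{G}_F$ and $\varphi_a$ are regarded as maps of the unit circle $\mathbb{T}$. *)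

(* Defs.v *)
From HB Require Import structures.
From mathcomp Require Import all_boot all_order all_algebra.
From mathcomp Require Import all_classical all_reals all_analysis.
From mathcomp Require Import complex.
Set Implicit Arguments. Unset Strict Implicit. Unset Printing Implicit Defensive.
Import Order.TTheory GRing.Theory Num.Theory.
Import numFieldTopology.Exports numFieldNormedType.Exports.
Local Open Scope ring_scope.
Local Open Scope classical_set_scope.

(* topology on C = R[i]: the metric topology of its norm (copied from the
   generic instance for numeric fields, which is not found automatically) *)
HB.instance Definition _ (R : realType) := PseudoPointedMetric.copy R[i] (R[i])^o.

Section Blaschke.
Variable R : realType.
Local Notation C := R[i].

Definition circle : set C := [set z | `|z| = 1].

Definition blaschke (gamma : C) (s : seq C) (z : C) : C :=
  gamma * \prod_(a <- s) ((z - a) / (1 - Num.conj a * z)).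

(* F is a finite Blaschke product of degree d (as a function on C;
   only its values on the closed disc matter in the statements below) *)
Definition is_blaschke (d : nat) (F : C -> C) : Prop :=
  exists (gamma : C) (s : seq C),
    [/\ `|gamma| = 1, size s = d, all (fun a => `|a| < 1) s &
        forall z, F z = blaschke gamma s z].

(* the group of invariants G_F: continuous maps u : T -> T with F o u = F,
   represented by functions C -> C whose behaviour on T is what matters *)
Definition invariants (F : C -> C) (u : C -> C) : Prop :=
  [/\ {within circle, continuous u},
      (forall z, circle z -> circle (u z)) &
      (forall z, circle z -> F (u z) = F z)].

Definition eqT (u v : C -> C) : Prop := forall z, circle z -> u z = v z.

Definition gpow (g : C -> C) (m : nat) : C -> C := iter m g.

Definition generates (F : C -> C) (g : C -> C) : Prop :=
  invariants F g /\
  forall u, invariants F u ->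
    exists m : nat, eqT u (gpow g m) \/ eqT (gpow g m \o u) id.

(* H is a normal subgroup of index 2 of G (both given as predicates on maps
   of T, each being the invariant group of some Blaschke product) *)
Definition normal_index2 (H G : (C -> C) -> Prop) : Prop :=
  [/\ (forall u, H u -> G u),
      (forall u u' v, G u -> G u' -> eqT (u \o u') id -> eqT (u' \o u) id ->
          H v -> H (u \o v \o u')) &
      exists h, [/\ G h, ~ H h &
        forall u, G u -> H u \/ exists v, H v /\ eqT u (h \o v)]].

Fixpoint comp_upto (Cs : nat -> C -> C) (j : nat) : C -> C :=
  match j with
  | 0 => id
  | j'.+1 => Cs j'.+1 \o comp_upto Cs j'
  end.

Definition phi (a : C) (z : C) : C := (a - z) / (1 - Num.conj a * z).

End Blaschke.

(* Main.v *)
(** On the circle every degree 2 Blaschke product is C = p o sq o q with disc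
automorphisms p, q and sq(z) = z^2: up to an automorphism it is
z * phi_c(z) = phi_{e^2}(phi_e(z)^2), e being the hyperbolic midpoint of 0
and c. Hence C has a fixed point free deck involution s = q^-1(-q), and
C u = C v on the connected circle forces u = v or u = s v.

Let F be a composition of such maps and u an invariant of C o F. Then F u is F
or s F, which is a homomorphism to Z/2 with kernel G_F. It is onto: s lifts
through F. Only square roots are needed for that: if t(z) = z r(z)^(2^(k+1)),
then z r(z^2)^(2^k) is a lift of t through sq, and disc automorphisms are of
this form for every k. Inverses in G_(C o F) come from u o u in G_F.

Finally a generator of G_(C o F) must map to the nontrivial element of Z/2, so
its square generates G_F; after n - 1 squarings one gets a generator of
G_(C_1) = {id, phi_a}, which is phi_a as phi_a is not the identity. *)
Require Import Defs.
From HB Require Import structures.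
From mathcomp Require Import all_boot all_order all_algebra.
From mathcomp Require Import all_classical all_reals all_analysis.
From mathcomp Require Import complex ring.
Import Order.TTheory GRing.Theory Num.Theory.
Import numFieldTopology.Exports numFieldNormedType.Exports.
Local Open Scope ring_scope.

Section CircleMaps.
Local Open Scope classical_set_scope.
Set Implicit Arguments.
Unset Strict Implicit.
Variable R : realType.
Local Notation C := R[i].
Local Notation conj := (@Num.conj C).
Implicit Types (f g u v s F : C -> C) (a b c e z w x : C) (k : nat).

(** * Continuous self-maps of the circle and their square roots *)

Definition cts_circle f := {within @circle R, continuous f}.

Lemma cts_circleP f :
  cts_circle f <->
  forall z, circle z -> f x @[x --> within (@circle R) (nbhs z)] --> f z.
Proof. exact: subspace_continuousP. Qed.

Lemma cts_circleM f g :
  cts_circle f -> cts_circle g -> cts_circle (fun z => f z * g z).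
Proof.
move=> /cts_circleP hf /cts_circleP hg; apply/cts_circleP => z cz.
exact: (@cvgM C _ _ _ f g _ _ (hf z cz) (hg z cz)).
Qed.

Lemma cts_circleD f g :
  cts_circle f -> cts_circle g -> cts_circle (fun z => f z + g z).
Proof.
move=> /cts_circleP hf /cts_circleP hg; apply/cts_circleP => z cz.
exact: (@cvgD C C^o _ _ _ f g _ _ (hf z cz) (hg z cz)).
Qed.

Lemma cts_circleV f :
  (forall z, circle z -> f z != 0) -> cts_circle f ->
  cts_circle (fun z => (f z)^-1).
Proof.
move=> f0 /cts_circleP hf; apply/cts_circleP => z cz.
exact: (@cvgV C _ _ _ f _ (f0 z cz) (hf z cz)).
Qed.

Lemma cts_circle_norm f : cts_circle f -> cts_circle (fun z => `|f z|).
Proof.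
move=> /cts_circleP hf; apply/cts_circleP => z cz.
exact: (@cvg_norm C C^o _ _ _ f _ (hf z cz)).
Qed.

Lemma cts_circle_cst c : cts_circle (fun=> c).
Proof. by apply/cts_circleP => z cz; exact: cvg_cst. Qed.

Lemma cts_circle_id : cts_circle id.
Proof. by apply/cts_circleP => z cz; exact: cvg_within. Qed.

Lemma cts_circleX f k : cts_circle f -> cts_circle (fun z => f z ^+ k).
Proof.
move=> hf; elim: k => [|k IH]; first exact: cts_circle_cst.
have -> : (fun z => f z ^+ k.+1) = (fun z => f z * f z ^+ k).
  by apply/funext => z; rewrite exprS.
exact: cts_circleM.
Qed.

Lemma cts_circle_comp f g :
  (forall z, circle z -> circle (g z)) ->
  cts_circle f -> cts_circle g -> cts_circle (f \o g).
Proof.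
move=> gT /cts_circleP hf /cts_circleP hg; apply/cts_circleP => z cz P hP.
have hQ := hg _ cz _ (hf _ (gT _ cz) P hP).
apply: (@filterS _ (nbhs z) _ _ _ _ hQ) => x /= Px cx.
exact: Px (gT _ cx).
Qed.

Lemma eq_cts_circle f g : eqT f g -> cts_circle f -> cts_circle g.
Proof.
move=> fg /cts_circleP hf; apply/cts_circleP => z cz; rewrite -fg //.
move=> P hP; have hQ := hf _ cz _ hP.
apply: (@filterS _ (nbhs z) _ _ _ _ hQ) => x /= Px cx.
by rewrite -fg //; exact: Px.
Qed.

Lemma circle_neq0 z : circle z -> z != 0.
Proof. by rewrite /circle /= -normr_gt0 => ->; exact: ltr01. Qed.

Lemma circle_conj z : circle z -> conj z = z^-1.
Proof.
move=> cz; apply: (mulfI (circle_neq0 cz)).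
by rewrite -normCK cz expr1n divff // circle_neq0.
Qed.

Lemma circleM z w : circle z -> circle w -> circle (z * w).
Proof. by rewrite /circle /= normrM => -> ->; rewrite mulr1. Qed.

Lemma circleV z : circle z -> circle z^-1.
Proof. by rewrite /circle /= normfV => ->; rewrite invr1. Qed.

Lemma circleX z k : circle z -> circle (z ^+ k).
Proof. by rewrite /circle /= normrX => ->; rewrite expr1n. Qed.

Lemma circleN z : circle z -> circle (- z).
Proof. by rewrite /circle /= normrN. Qed.

Lemma circle1 : circle (1 : C).
Proof. exact: normr1. Qed.

Lemma circle_root z k : circle z -> (0 < k)%N -> exists2 w, circle w & w ^+ k = z.
Proof.
move=> cz k0; exists (k.-root z); last by rewrite rootCK.
apply/eqP; rewrite -(@pexpr_eq1 _ _ k) ?normr_ge0 //.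
by rewrite -normrX rootCK // cz.
Qed.

Definition circle_map f := cts_circle f /\ (forall z, circle z -> circle (f z)).

Lemma circle_map_id : circle_map id.
Proof. by split => //; exact: cts_circle_id. Qed.

Lemma circle_map_cst c : circle c -> circle_map (fun=> c).
Proof. by split => //; exact: cts_circle_cst. Qed.

Lemma circle_mapM f g :
  circle_map f -> circle_map g -> circle_map (fun z => f z * g z).
Proof.
move=> [cf Tf] [cg Tg]; split; first exact: cts_circleM.
by move=> z cz; apply: circleM; [exact: Tf|exact: Tg].
Qed.

Lemma circle_mapX f k : circle_map f -> circle_map (fun z => f z ^+ k).
Proof.
move=> [cf Tf]; split; first exact: cts_circleX.
by move=> z cz; apply/circleX/Tf.
Qed.

Lemma circle_map_comp f g : circle_map f -> circle_map g -> circle_map (f \o g).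
Proof.
move=> [cf Tf] [cg Tg]; split; first exact: cts_circle_comp.
by move=> z cz; apply/Tf/Tg.
Qed.

Lemma eq_circle_map f g : eqT f g -> circle_map f -> circle_map g.
Proof.
move=> fg [cf Tf]; split; first exact: eq_cts_circle cf.
by move=> z cz; rewrite -fg //; exact: Tf.
Qed.

(** For [w] on the circle, [w != -1], the root is [(1 + w) / |1 + w|]: its square is
    [(1 + w) / (1 + w^-1) = w]. It has positive real part, so it avoids [-1] as well and root
    extraction can be iterated. *)
Lemma circle_map_sqrt f : circle_map f -> (forall z, circle z -> f z != -1) ->
  exists r, [/\ circle_map r, forall z, circle z -> r z != -1 &
                forall z, circle z -> r z ^+ 2 = f z].
Proof.
move=> [cf Tf] fN1.
have f1 z : circle z -> `|1 + f z| != 0.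
  by move=> cz; rewrite normr_eq0 addrC -(opprK 1) subr_eq0 fN1.
exists (fun z => (1 + f z) / `|1 + f z|); split.
- split.
    have c1f := cts_circleD (@cts_circle_cst 1) cf.
    exact: cts_circleM c1f (cts_circleV f1 (cts_circle_norm c1f)).
  by move=> z cz; rewrite /circle /= normrM normfV normr_id divff ?f1.
- move=> z cz; apply/negP => /eqP e.
  have : f z = - (1 + `|1 + f z|).
    have : 1 + f z = - `|1 + f z|.
      by rewrite -[LHS](divfK (f1 z cz)) e mulN1r.
    by move=> E; rewrite opprD -E; ring.
  move=> /(congr1 Num.norm); rewrite normrN (Tf z cz) ger0_norm ?addr_ge0 //.
  move=> /esym/eqP; rewrite -subr_eq0 addrAC subrr add0r.
  by rewrite (negbTE (f1 z cz)).
- move=> z cz; rewrite expr_div_n normCK rmorphD rmorph1 /= (circle_conj (Tf z cz)).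
  have fz0 := circle_neq0 (Tf z cz).
  have := f1 z cz; rewrite normr_eq0 => h; field.
  by rewrite fz0 addrC.
Qed.

Lemma circle_map_root f k : circle_map f -> (forall z, circle z -> f z != -1) ->
  exists2 r, circle_map r & forall z, circle z -> r z ^+ (2 ^ k) = f z.
Proof.
elim: k f => [|k IH] f mf fN1; first by exists f.
have [r [mr rN1 r2]] := circle_map_sqrt mf fN1.
have [q mq qr] := IH _ mr rN1.
by exists q => // z cz; rewrite expnSr exprM qr // r2.
Qed.

(** * Disc automorphisms on the circle, and roots of the quotient [s z / z] *)

Lemma phi_den_neq0 a z : `|a| < 1 -> `|z| <= 1 -> 1 - conj a * z != 0.
Proof.
move=> a1 z1; rewrite subr_eq0; apply/negP => /eqP/(congr1 Num.norm).
rewrite normr1 normrM norm_conjC => e.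
have : `|a| * `|z| <= `|a| by rewrite ler_piMr.
by rewrite -e => /(lt_le_trans a1); rewrite ltxx.
Qed.

Lemma phi_circle_den a z : `|a| < 1 -> circle z -> 1 - conj a * z != 0.
Proof. by move=> a1 cz; apply: phi_den_neq0; rewrite ?cz. Qed.

Lemma phi_self_den a : `|a| < 1 -> 1 - conj a * a != 0.
Proof. by move=> a1; rewrite phi_den_neq0 // ltW. Qed.

Lemma phiK a z : `|a| < 1 -> circle z -> phi a (phi a z) = z.
Proof.
move=> a1 cz; rewrite /phi.
have h1 := phi_circle_den a1 cz; have h2 := phi_self_den a1.
field; rewrite h1 /=; apply: contraNneq h2 => e0.
by apply/eqP; rewrite -e0; ring.
Qed.

Lemma phi_circle a z : `|a| < 1 -> circle z -> circle (phi a z).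
Proof.
move=> a1 cz; rewrite /circle /= /phi normrM normfV.
have h1 := phi_circle_den a1 cz.
suff -> : `|a - z| = `|1 - conj a * z| by rewrite divff ?normr_eq0.
rewrite -[RHS]norm_conjC rmorphB rmorph1 rmorphM /= conjCK (circle_conj cz).
rewrite distrC -[RHS]mulr1 -[X in _ = _ * X]cz -normrM.
by rewrite mulrBl mul1r mulfVK ?circle_neq0.
Qed.

Lemma phi_circle_map a : `|a| < 1 -> circle_map (phi a).
Proof.
move=> a1; split; last by move=> z; exact: phi_circle.
apply: (@cts_circleM (fun z => a - z) (fun z => (1 - conj a * z)^-1)).
  have -> : (fun z => a - z) = (fun z => a + -1 * z).
    by apply/funext => z; rewrite mulN1r.
  exact: cts_circleD (@cts_circle_cst a)
    (cts_circleM (@cts_circle_cst (-1)) cts_circle_id).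
apply: cts_circleV => [z cz|]; first exact: phi_circle_den.
have -> : (fun z => 1 - conj a * z) = (fun z => 1 + - conj a * z).
  by apply/funext => z; rewrite mulNr.
exact: cts_circleD (@cts_circle_cst 1)
  (cts_circleM (@cts_circle_cst (- conj a)) cts_circle_id).
Qed.

Lemma phi_comp a b : `|a| < 1 -> `|b| < 1 ->
  exists c r, [/\ `|c| < 1, circle r &
    forall z, circle z -> phi a (phi b z) = r * phi c z].
Proof.
move=> a1 b1.
have hab : 1 - conj a * b != 0 by rewrite phi_den_neq0 // ltW.
have hba : 1 - conj b * a != 0 by rewrite phi_den_neq0 // ltW.
have Econj : conj (1 - conj b * a) = 1 - conj a * b.
  by rewrite rmorphB rmorph1 rmorphM /= conjCK mulrC.
have Nab : `|1 - conj a * b| = `|1 - conj b * a|.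
  by rewrite -Econj norm_conjC.
have c1 : `|(b - a) / (1 - conj b * a)| < 1.
  rewrite normrM normfV ltr_pdivrMr ?normr_gt0 // mul1r.
  rewrite -(@ltr_pXn2r _ 2) ?nnegrE ?normr_ge0 //.
  rewrite -subr_gt0.
  have -> : `|1 - conj b * a| ^+ 2 - `|b - a| ^+ 2 =
            (1 - `|a| ^+ 2) * (1 - `|b| ^+ 2).
    by rewrite !normCK Econj rmorphB /=; ring.
  by rewrite mulr_gt0 // subr_gt0 expr_lt1.
(* [c] is [phi b a], the zero of the composite because [phi b] is an involution; comparing
   numerators then gives the rotation. *)
exists ((b - a) / (1 - conj b * a)), (- ((1 - conj b * a) / (1 - conj a * b))).
split=> //.
  apply: circleN; rewrite /circle /= normrM normfV Nab divff //.
  by rewrite normr_eq0.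
move=> z cz; rewrite /phi.
have hb := phi_circle_den b1 cz.
have hd := phi_circle_den c1 cz.
have hd2 := phi_circle_den a1 (phi_circle b1 cz).
have Ec : conj ((b - a) / (1 - conj b * a)) =
    (conj b - conj a) / (1 - conj a * b).
  by rewrite fmorph_div /= Econj rmorphB.
rewrite Ec in hd *.
rewrite [RHS]mulrA; apply/eqP; rewrite eqr_div //.
apply/eqP; field; by rewrite ?hab ?hba ?hb.
Qed.

(* [e] is the hyperbolic midpoint of [0] and [c], the fixed point of
   [phi c] in the disc and the critical point of [z * phi c z]. *)
Lemma blaschke_critical_point c : `|c| < 1 ->
  exists2 e, `|e| < 1 &
    forall z, circle z -> z * phi c z = phi (e ^+ 2) (phi e z ^+ 2).
Proof.
move=> c1.
pose s := sqrtC (1 - `|c| ^+ 2).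
have s0 : 0 <= s by rewrite sqrtC_ge0 subr_ge0 exprn_ile1 // ltW.
have s2 : s ^+ 2 = 1 - `|c| ^+ 2 by rewrite sqrtCK.
have t0 : 1 + s != 0 by rewrite gt_eqF // ltr_wpDr.
pose e := c / (1 + s).
have e1 : `|e| < 1.
  rewrite /e normrM normfV (@ger0_norm _ (1 + s)) ?addr_ge0 //.
  by rewrite ltr_pdivrMr ?ltr_wpDr // mul1r (lt_le_trans c1) // lerDl.
exists e => // z cz.
have Ee : conj e = conj c / (1 + s).
  by rewrite fmorph_div rmorphD rmorph1 /= (CrealP (ger0_real s0)).
have d0 : 1 + conj e * e != 0.
  by rewrite mulrC -normCK gt_eqF // ltr_wpDr ?exprn_ge0.
(* Writing [c] in terms of [e] eliminates the square root [s]; the claim becomes a rational identity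
   in [e], [conj e] and [z]. *)
have cE : c = 2 * e / (1 + conj e * e).
  apply: (mulIf d0); rewrite mulfVK // Ee /e.
  have -> : conj c / (1 + s) * (c / (1 + s)) = (1 - s ^+ 2) / (1 + s) ^+ 2.
    by rewrite s2 normCK; field.
  by field.
have ccE : conj c = 2 * conj e / (1 + conj e * e).
  have E : conj (1 + conj e * e) = 1 + conj e * e.
    by rewrite rmorphD rmorph1 rmorphM /= conjCK mulrC.
  by rewrite {1}cE fmorph_div /= E rmorphM /= rmorph_nat.
have h1 := phi_circle_den c1 cz.
have h2 := phi_circle_den e1 cz.
have e21 : `|e ^+ 2| < 1 by rewrite normrX expr_lt1.
have h3 := phi_circle_den e21 (circleX 2 (phi_circle e1 cz)).
rewrite /phi in h3 *; rewrite [LHS]mulrA; apply/eqP; rewrite eqr_div //.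
rewrite ccE cE rmorphXn /=; apply/eqP; field.
by rewrite d0 h2.
Qed.

(* [rootable k s] replaces the condition that [s] has degree 1: it provides
   the square roots needed to lift [s] through [k] maps of degree 2. *)
Definition rootable k s :=
  exists2 r, circle_map r & forall z, circle z -> s z = z * r z ^+ (2 ^ k).

Lemma rootable_map k s : rootable k s -> circle_map s.
Proof.
move=> [r mr sE]; apply: (@eq_circle_map (fun z => z * r z ^+ (2 ^ k))).
  by move=> z cz; rewrite sE.
exact: circle_mapM circle_map_id (circle_mapX _ mr).
Qed.

Lemma rootable_comp k s s' : rootable k s -> rootable k s' ->
  rootable k (s \o s').
Proof.
move=> [r mr sE] hs'; have ms' := rootable_map hs'.
have [r' mr' s'E] := hs'.
exists (fun z => r' z * r (s' z)).
  exact: circle_mapM mr' (circle_map_comp mr ms').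
move=> z cz; rewrite /comp sE; last exact: ms'.2.
by rewrite {1}s'E // exprMn mulrA.
Qed.

Lemma rootable_rot k c : circle c -> rootable k (fun z => c * z).
Proof.
move=> cc; have [w cw wE] := circle_root cc (expn_gt0 2 k : 0 < 2 ^ k)%N.
exists (fun=> w); first exact: circle_map_cst.
by move=> z cz; rewrite wE mulrC.
Qed.

(** With [w = 1 - a / z], on the circle [phi a z = - z * w / conj w = - z * (w / |w|) ^+ 2]. As
    [|a| < 1], [w] stays in the right half-plane, so [w / |w|] avoids [-1] and has a continuous root
    of order [2 ^ k]; the sign is absorbed by a constant root of [-1]. *)
Lemma rootable_phi k a : `|a| < 1 -> rootable k (phi a).
Proof.
move=> a1; pose w z : C := 1 - a * z^-1.
have wconj z : circle z -> conj (w z) = 1 - conj a * z.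
  move=> cz; rewrite rmorphB rmorph1 rmorphM /=.
  by rewrite -(circle_conj cz) conjCK.
have w0 z : circle z -> w z != 0.
  by move=> cz; rewrite -conjC_eq0 wconj // phi_circle_den.
have nw0 z : circle z -> `|w z| != 0 by move=> cz; rewrite normr_eq0 w0.
have cw : cts_circle w.
  have -> : w = (fun z => 1 + - a * z^-1).
    by apply/funext => z; rewrite mulNr.
  apply: (@cts_circleD (fun=> 1) (fun z => - a * z^-1) (@cts_circle_cst 1)).
  apply: (@cts_circleM (fun=> - a) (fun z => z^-1) (@cts_circle_cst (- a))).
  by apply: (@cts_circleV id _ cts_circle_id) => z; exact: circle_neq0.
pose q z := w z / `|w z|.
have mq : circle_map q.
  split; first exact: cts_circleM cw (cts_circleV nw0 (cts_circle_norm cw)).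
  by move=> z cz; rewrite /circle /= normrM normfV normr_id divff ?nw0.
have qN1 z : circle z -> q z != -1.
  move=> cz; apply/negP => /eqP e.
  have E : w z = - `|w z| by rewrite -[LHS](divfK (nw0 z cz)) -/(q z) e mulN1r.
  have : a * z^-1 = 1 + `|w z|.
    by apply/eqP; rewrite eq_sym -subr_eq0 -[X in 1 + X]opprK -E /w; apply/eqP; ring.
  move=> /(congr1 Num.norm); rewrite normrM (circleV cz) mulr1.
  rewrite (@ger0_norm _ (1 + _)) ?addr_ge0 // => aE.
  have : 1 <= `|a| by rewrite aE lerDl.
  by move=> /(lt_le_trans a1); rewrite ltxx.
have [r mr rE] := circle_map_root k mq qN1.
have [c cc cE] := circle_root (circleN circle1) (expn_gt0 2 k : 0 < 2 ^ k)%N.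
exists (fun z => c * r z ^+ 2).
  exact: circle_mapM (circle_map_cst cc) (circle_mapX 2 mr).
move=> z cz; rewrite exprMn cE exprAC rE // /q expr_div_n normCK wconj //.
rewrite -(wconj z cz) invfM /phi -(wconj z cz).
have h1 := w0 z cz; have h2 : conj (w z) != 0 by rewrite conjC_eq0.
have -> : a - z = - z * w z.
  by rewrite /w; have := circle_neq0 cz => z0; field.
field; apply/andP; split; [exact: h2|exact: h1].
Qed.

(** Stands in for a disc automorphism. Roots are demanded of the inverse too, so that conjugation by
    [s] preserves [rootable]. *)
Definition circle_auto s := exists s',
  [/\ forall k, rootable k s, forall k, rootable k s',
      eqT (s \o s') id & eqT (s' \o s) id].

Lemma circle_auto_map s : circle_auto s -> circle_map s.
Proof. by move=> [s' [h _ _ _]]; exact: rootable_map (h 0%N). Qed.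

Lemma circle_auto_comp s t : circle_auto s -> circle_auto t ->
  circle_auto (s \o t).
Proof.
move=> hs ht; have [_ Ts] := circle_auto_map hs.
have [s' [rs rs' sK s'K]] := hs; have [t' [rt rt' tK t'K]] := ht.
have [_ Ts'] := rootable_map (rs' 0%N); have [_ Tt] := circle_auto_map ht.
exists (t' \o s'); split => [k|k|z cz|z cz].
- exact: rootable_comp.
- exact: rootable_comp.
- rewrite /= [t (t' _)]tK; first exact: sK.
  exact: Ts'.
- rewrite /= [s' (s _)]s'K; first exact: t'K.
  exact: Tt.
Qed.

Lemma circle_auto_phi a : `|a| < 1 -> circle_auto (phi a).
Proof.
move=> a1; exists (phi a).
by split=> [k|k|z cz|z cz]; [exact: rootable_phi|exact: rootable_phi|
  exact: phiK|exact: phiK].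
Qed.

Lemma circle_auto_rot c : circle c -> circle_auto (fun z => c * z).
Proof.
move=> cc; exists (fun z => c^-1 * z).
split=> [k|k|z cz|z cz].
- exact: rootable_rot.
- exact/rootable_rot/circleV.
- by rewrite /= mulVKf // circle_neq0.
- by rewrite /= mulKf // circle_neq0.
Qed.

(** * Degree 2 Blaschke products as the squaring map up to automorphisms *)

Definition squaring_like F := exists p q,
  [/\ circle_auto p, circle_auto q & eqT F (fun z => p (q z ^+ 2))].

(** The product is [gamma * phi a z * phi b z]. Putting [x = phi b z], hence [z = phi b x], turns it
    into [gamma * r * (x * phi c x)], to which the midpoint identity applies. *)
Lemma blaschke2_squaring_like F : is_blaschke 2 F -> squaring_like F.
Proof.
move=> [gamma [s [cg sz s1 FE]]].
case: s sz s1 FE => [|a [|b []]] // _ /= /and3P[a1 b1 _] FE.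
have [c [r [c1 cr phiE]]] := phi_comp a1 b1.
have [e e1 eE] := blaschke_critical_point c1.
have e21 : `|e ^+ 2| < 1 by rewrite normrX expr_lt1.
exists ((fun z => gamma * r * z) \o phi (e ^+ 2)), (phi e \o phi b); split.
- apply: circle_auto_comp (circle_auto_phi e21).
  exact/circle_auto_rot/circleM.
- exact: circle_auto_comp (circle_auto_phi e1) (circle_auto_phi b1).
- move=> z cz; have cx := phi_circle b1 cz.
  rewrite /= -(eE _ cx) FE /blaschke !big_cons big_nil mulr1.
  have -> : (z - a) / (1 - conj a * z) = - phi a z by rewrite /phi -[RHS]mulNr opprB.
  have -> : (z - b) / (1 - conj b * z) = - phi b z by rewrite /phi -[RHS]mulNr opprB.
  rewrite -{1}(phiK b1 cz) (phiE _ cx); ring.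
Qed.

Lemma squaring_like_map F : squaring_like F -> circle_map F.
Proof.
move=> [p [q [ap aq FE]]]; apply: (@eq_circle_map (p \o (fun z => q z ^+ 2))).
  by move=> z cz; rewrite FE.
exact: circle_map_comp (circle_auto_map ap) (circle_mapX 2 (circle_auto_map aq)).
Qed.

(** Conjugation absorbs [p] and [q], leaving a lift through the square, which costs one square root:
    the exponent drops from [2 ^ k.+1] to [2 ^ k]. *)
Lemma squaring_like_lift F k s : squaring_like F -> rootable k.+1 s ->
  exists2 s', rootable k s' & eqT (F \o s') (s \o F).
Proof.
move=> [p [q [ap aq FE]]] rs.
have [_ Tp] := circle_auto_map ap; have [_ Tq] := circle_auto_map aq.
have [_ Ts] := rootable_map rs.
have [p' [rp rp' pK p'K]] := ap; have [q' [rq rq' qK q'K]] := aq.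
have [r mr rE] : rootable k.+1 (p' \o (s \o p)).
  exact: rootable_comp (rp' _) (rootable_comp rs (rp _)).
pose t z := z * r (z ^+ 2) ^+ (2 ^ k).
have msq : circle_map (fun z => z ^+ 2) := circle_mapX 2 circle_map_id.
have rt : rootable k t.
  by exists (r \o (fun z => z ^+ 2)) => //; exact: circle_map_comp.
exists (q' \o (t \o q)); first exact: rootable_comp (rq' _) (rootable_comp rt (rq _)).
have [_ Tt] := rootable_map rt.
have [_ Tq'] := rootable_map (rq' 0%N).
move=> z cz; have cq := Tq _ cz; have ctq := Tt _ cq.
rewrite /= FE; last exact: Tq'.
rewrite [q (q' _)]qK // (FE z cz) /t exprMn -exprM -expnSr.
rewrite -(rE _ (circleX 2 cq)) /= [p (p' _)]pK //.
by apply/Ts/Tp/circleX.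
Qed.

(** * Connectedness of the circle *)

Local Notation Re := complex.Re.

Lemma normc_real_complex (t : R) : `|t%:C%C| = (`|t|%:C)%C :> C.
Proof. by rewrite normc_def /= expr0n addr0 sqrtr_sqr. Qed.

Lemma continuous_real_complex : continuous (fun t : R => t%:C%C : C).
Proof.
move=> t; apply/(@cvgrPdist_lt C C^o) => eps e0.
have eE := RRe_real (gtr0_real e0).
have e0' : 0 < Re eps by rewrite -ltcR eE.
have H := @nbhsx_ballx R R^o t _ e0'.
apply: (@filterS _ (nbhs t) _ _ _ _ H) => x xt.
by rewrite -eE -rmorphB /= normc_real_complex ltcR.
Qed.

Lemma continuous_Re : continuous (fun z : C => Re z).
Proof.
move=> z; apply/(@cvgrPdist_lt R R^o C (nbhs z) (nbhs_filter z)) => eps e0.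
have e0' : 0 < (eps%:C)%C :> C by rewrite ltcR.
have H := @nbhsx_ballx C C^o z _ e0'.
apply: (@filterS _ (nbhs z) _ _ _ _ H) => x xz.
rewrite -ltcR; apply: le_lt_trans xz.
have := normc_ge_Re (z - x).
by rewrite raddfB.
Qed.

(* The square of the Cayley transform maps the line onto the whole circle;
   the transform itself misses -1. *)
Definition circle_param (t : R) : C :=
  ((1 + 'i * t%:C%C) / (1 - 'i * t%:C%C)) ^+ 2.

Lemma conj_i_real (t : R) : conj ('i * t%:C%C) = - ('i * t%:C%C).
Proof.
rewrite rmorphM /= conjCi mulNr; congr (- (_ * _)).
by apply/CrealP/complex_realP; exists t.
Qed.

Lemma circle_param_den (t : R) : 1 - 'i * t%:C%C != 0 :> C.
Proof.
apply/negP => /eqP e; have := congr1 conj e.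
rewrite rmorphB rmorph1 /= conj_i_real opprK conjC0 => e'.
have : (1 - 'i * t%:C%C) + (1 + 'i * t%:C%C) = 0 :> C by rewrite e e' addr0.
rewrite addrACA (addrC (- _)) subrr addr0 => /eqP.
by rewrite -(natrD _ 1 1) pnatr_eq0.
Qed.

Lemma circle_param_circle t : circle (circle_param t).
Proof.
apply: circleX; rewrite /circle /= normrM normfV.
rewrite -[X in X / _]norm_conjC rmorphD rmorph1 /= conj_i_real.
by rewrite divff // normr_eq0 circle_param_den.
Qed.

Lemma circle_param_surj z : circle z -> exists t, circle_param t = z.
Proof.
move=> cz.
(* At least one of the two square roots of [z] is in the range of the Cayley transform; [t] below is
   its preimage, real because [conj y = y^-1]. *)
have [y [cy y1 yz]] : exists y, [/\ circle y, y != -1 & y ^+ 2 = z].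
  have [w cw wz] := circle_root cz (isT : 0 < 2)%N.
  have [w1|w1] := eqVneq w (-1); last by exists w.
  exists (- w); rewrite sqrrN; split => //; first exact: circleN.
  by rewrite w1 opprK -subr_eq0 opprK -(natrD _ 1 1) pnatr_eq0.
have y10 : 1 + y != 0 by rewrite addrC -(opprK 1) subr_eq0.
have y0 := circle_neq0 cy.
pose t : C := 'i * ((1 - y) / (1 + y)).
have tr : t \is Num.real.
  apply/CrealP; rewrite /t rmorphM /= conjCi fmorph_div rmorphB rmorphD rmorph1 /=.
  rewrite (circle_conj cy); field.
  by rewrite y10 y0.
have /complex_realP[r rE] := tr.
exists r; rewrite /circle_param -rE -yz; congr (_ ^+ 2).
have i2 : 'i * t = - ((1 - y) / (1 + y)) by rewrite /t mulrA -expr2 sqrCi mulN1r.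
have E1 : 1 - (1 - y) / (1 + y) = 2 * y / (1 + y) by field.
have E2 : 1 + (1 - y) / (1 + y) = 2 / (1 + y) by field.
rewrite i2 opprK E1 E2; field.
by rewrite y10.
Qed.

Lemma circle_param_cts : continuous circle_param.
Proof.
have ci c : continuous (fun t : R => 1 + c * t%:C%C : C).
  move=> t.
  apply: (@cvgD C C^o _ _ _ (fun=> 1) (fun t : R => c * t%:C%C)).
    exact: cvg_cst.
  apply: (@cvgM C _ _ _ (fun=> c) (fun t : R => t%:C%C)); first exact: cvg_cst.
  exact: continuous_real_complex.
move=> t.
pose q (x : R) : C := (1 + 'i * x%:C%C) / (1 + - 'i * x%:C%C).
have ct : q @ t --> q t.
  apply: (@cvgM C); first exact: ci.
  apply: (@cvgV C); last exact: ci.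
  by rewrite mulNr circle_param_den.
have -> : circle_param = fun x : R => q x * q x.
  by apply/funext => x; rewrite /q mulNr -expr2.
exact: (@cvgM C _ _ _ _ _ _ _ ct ct).
Qed.

(** Pulled back to the line by [circle_param], the real part of [f] is continuous with values 1 and
    -1; by the intermediate value theorem a change of sign would force a zero. *)
Lemma cts_circle_sign f : cts_circle f ->
  (forall z, circle z -> f z = 1 \/ f z = -1) ->
  (forall z, circle z -> f z = 1) \/ (forall z, circle z -> f z = -1).
Proof.
move=> /cts_circleP cf f1.
pose h (t : R) : R := Re (f (circle_param t)).
have ch : continuous h.
  move=> t; apply: (@continuous_comp _ _ _ (f \o circle_param) (fun z => Re z));
    last exact: continuous_Re.
  move=> P /(cf _ (circle_param_circle t)) hP.
  have H := circle_param_cts hP.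
  apply: (@filterS _ (nbhs t) _ _ _ _ H) => x /= Px.
  exact: Px (circle_param_circle x).
have h1 t : h t != 0.
  rewrite /h; case: (f1 _ (circle_param_circle t)) => -> /=.
    exact: oner_neq0.
  by rewrite oppr_eq0 oner_neq0.
have same (a b : R) : h a < 0 -> 0 < h b -> False.
  move=> ha hb.
  have le_ab : Num.min a b <= Num.max a b by rewrite ge_min !le_max !lexx.
  have [|c _ hc] := @IVT R h _ _ 0 le_ab (continuous_subspaceT ch).
    by case: (leP a b) => _; rewrite ?ge_min ?le_max (ltW ha) (ltW hb) ?orbT.
  by have := h1 c; rewrite hc eqxx.
have hE t z : circle_param t = z -> f z = if 0 < h t then 1 else -1.
  move=> <-; rewrite /h; case: (f1 _ (circle_param_circle t)) => -> /=.
    by rewrite ltr01.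
  by rewrite ltr0N1.
have [t0p|t0n] := ltP 0 (h 0); [left|right] => z cz.
  have [t tz] := circle_param_surj cz; rewrite (hE _ _ tz).
  case: ltP => // ht; have /same : h t < 0 by rewrite lt_neqAle h1.
  by move=> /(_ _ t0p).
have [t tz] := circle_param_surj cz; rewrite (hE _ _ tz).
case: ltP => // ht; have /same : h 0 < 0 by rewrite lt_neqAle h1.
by move=> /(_ _ ht).
Qed.

(** * Deck involutions *)

(** The last clause packages connectedness: the choice between [v] and [s \o v] is made once for the
    whole circle, not pointwise. *)
Definition deck_involution F s :=
  [/\ forall k, rootable k s, eqT (s \o s) id,
      forall z, circle z -> s z <> z, eqT (F \o s) F &
      forall u v, circle_map u -> circle_map v -> eqT (F \o u) (F \o v) ->
        eqT u v \/ eqT u (s \o v)].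

(** The involution is [w -> - w] conjugated by [q]. If [F \o u] and [F \o v] agree, the quotient of
    [q \o u] by [q \o v] is continuous with square 1, hence a constant sign. *)
Lemma squaring_like_deck F : squaring_like F -> exists s, deck_involution F s.
Proof.
move=> [p [q [ap aq FE]]].
have [_ Tq] := circle_auto_map aq.
have [p' [_ _ _ p'K]] := ap; have [q' [rq rq' qK q'K]] := aq.
have [_ Tq'] := rootable_map (rq' 0%N).
exists (q' \o ((fun w => -1 * w) \o q)); split.
- move=> k; apply: rootable_comp (rq' k) (rootable_comp _ (rq k)).
  exact/rootable_rot/circleN/circle1.
- move=> z cz; have cq := circleN (Tq _ cz).
  by rewrite /= !mulN1r [q (q' _)]qK //= opprK [q' (q _)]q'K.
- move=> z cz /= /(congr1 q); have cq := circleN (Tq _ cz).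
  rewrite mulN1r [q (q' _)]qK //= => /eqP.
  rewrite -subr_eq0 -opprD oppr_eq0 -mulr2n mulrn_eq0 /=.
  by rewrite (negbTE (circle_neq0 (Tq _ cz))).
- move=> z cz; have cq := circleN (Tq _ cz).
  by rewrite /= mulN1r !FE //= ?[q (q' _)]qK //= ?sqrrN //; exact: Tq'.
- move=> u v mu mv Fuv.
  have [_ Tqu] := circle_map_comp (circle_auto_map aq) mu.
  have [cqv Tqv] := circle_map_comp (circle_auto_map aq) mv.
  have qv0 z : circle z -> q (v z) != 0 by move=> cz; exact: circle_neq0 (Tqv _ cz).
  have sqE z : circle z -> q (u z) ^+ 2 = q (v z) ^+ 2.
    move=> cz; have := Fuv z cz; rewrite /= !FE; try exact: mu.2; try exact: mv.2.
    move=> /(congr1 p').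
    rewrite [p' (p (q (u z) ^+ 2))](p'K _ (circleX 2 (Tqu _ cz))).
    by rewrite [p' (p (q (v z) ^+ 2))](p'K _ (circleX 2 (Tqv _ cz))).
  have [] := @cts_circle_sign (fun z => q (u z) * (q (v z))^-1).
  + apply: cts_circleM (cts_circleV qv0 cqv).
    exact: (circle_map_comp (circle_auto_map aq) mu).1.
  + move=> z cz; have /eqP := sqE _ cz; rewrite eqf_sqr => /orP[]/eqP ->.
      by left; rewrite divff ?qv0.
    by right; rewrite mulNr divff ?qv0.
  + move=> E; left => z cz.
    have quv : q (u z) = q (v z) by rewrite -[LHS](divfK (qv0 z cz)) E // mul1r.
    rewrite -[LHS](q'K _ (mu.2 _ cz)) /= quv.
    exact: q'K (mv.2 _ cz).
  + move=> E; right => z cz.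
    have quv : q (u z) = -1 * q (v z) by rewrite -[LHS](divfK (qv0 z cz)) E.
    by rewrite /= -quv; rewrite -[LHS](q'K _ (mu.2 _ cz)).
Qed.

(** * Groups of invariants when one outer factor is added *)

Lemma invariants_map F u : invariants F u -> circle_map u.
Proof. by case. Qed.

Lemma invariants_comp F u v :
  invariants F u -> invariants F v -> invariants F (u \o v).
Proof.
move=> iu iv; have [cuv Tuv] := circle_map_comp (invariants_map iu) (invariants_map iv).
case: iu iv => [_ _ Fu] [_ Tv Fv].
by split => // z cz; rewrite /= Fu ?Fv //; exact: Tv.
Qed.

Lemma invariants_gpow F g m : invariants F g -> invariants F (gpow g m).
Proof.
move=> ig; elim: m => [|m IH]; last exact: invariants_comp ig IH.
by split => //; exact: cts_circle_id.
Qed.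

(** Every [k] is demanded because [F] will be a composition of arbitrarily many degree 2 maps, each
    costing one square root. *)
Definition lifts_rootable F := forall s, (forall k, rootable k s) ->
  exists2 s', circle_map s' & eqT (F \o s') (s \o F).

(** Invariants are only continuous maps by definition; that they have inverses is carried along the
    induction on the number of factors. *)
Definition invariants_invertible F := forall u, invariants F u ->
  exists v, [/\ invariants F v, eqT (u \o v) id & eqT (v \o u) id].

Section DoubleStep.
Variables G F s : C -> C.
Hypotheses (mF : circle_map F) (Gs : deck_involution G s).

Lemma invariants_sub u : invariants F u -> invariants (G \o F) u.
Proof. by move=> [cu Tu Fu]; split => // z cz; rewrite /= Fu. Qed.

Lemma invariants_cases u : invariants (G \o F) u ->
  invariants F u \/ eqT (F \o u) (s \o F).
Proof.
case: Gs => _ _ _ _ Gs2 iu; have mu := invariants_map iu.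
case: iu => cu Tu Gu.
have [E|E] := Gs2 (F \o u) F (circle_map_comp mF mu) mF Gu.
  by left; split.
by right.
Qed.

(** The two classes in Z/2 are disjoint since [s] has no fixed point; testing at 1 suffices. *)
Lemma swap_not_invariant u : invariants F u -> ~ eqT (F \o u) (s \o F).
Proof.
move=> [_ _ Fu] E; case: Gs => _ _ sN _ _.
have := E 1 circle1; rewrite /= (Fu _ circle1) => /esym.
exact: sN (mF.2 _ circle1).
Qed.

Lemma invariants_swap_comp u v : circle_map v ->
  eqT (F \o u) (s \o F) -> eqT (F \o v) (s \o F) -> eqT (F \o (u \o v)) F.
Proof.
move=> mv Eu Ev z cz; case: Gs => _ ss _ _ _.
rewrite [LHS](Eu _ (mv.2 _ cz)) /=; have := Ev z cz => /= ->.
exact: ss (mF.2 _ cz).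
Qed.

Lemma invariants_swap_exists : lifts_rootable F ->
  exists2 h, invariants (G \o F) h & eqT (F \o h) (s \o F).
Proof.
case: Gs => rs _ _ sG _ /(_ _ rs)[h [ch Th] hE]; exists h => //.
by split=> // z cz; rewrite /= (hE z cz : F (h z) = _); exact: sG (mF.2 _ cz).
Qed.

Lemma invariants_invertible_step :
  invariants_invertible F -> invariants_invertible (G \o F).
Proof.
move=> invF u iu; have [Fu|uE] := invariants_cases iu.
  have [v [iv uv vu]] := invF u Fu.
  by exists v; split=> //; exact: invariants_sub.
have mu := invariants_map iu.
have iuu : invariants F (u \o u).
  have [cuu Tuu] := circle_map_comp mu mu.
  by split=> // z cz; exact: (invariants_swap_comp mu uE uE cz).
have [w [iw uuw wuu]] := invF _ iuu.
have [_ Tw] := invariants_map iw.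
exists (w \o u); split => //; first exact: invariants_comp (invariants_sub iw) iu.
(* [w \o u] is a left inverse of [u] and [u \o w] a right one. *)
move=> z cz.
(* Insert [u \o u \o w] on the right of [w \o u], then cancel [w \o u \o u] on the left. *)
have E y : circle y -> w (u y) = u (w y).
  move=> cy; rewrite -[in LHS](uuw y cy) /=.
  by rewrite [LHS](wuu _ (mu.2 _ (Tw _ cy))).
by rewrite /= E //; exact: uuw.
Qed.

Lemma invariants_normal_index2 : lifts_rootable F -> invariants_invertible F ->
  normal_index2 (invariants F) (invariants (G \o F)).
Proof.
move=> lF invF; split.
- exact: invariants_sub.
- move=> u u' v iu iu' uu' u'u iv.
  have mu' := invariants_map iu'.
  have mvu' := circle_map_comp (invariants_map iv) mu'.
  have [cuvu Tuvu] := circle_map_comp (invariants_map iu) mvu'.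
  split => // z cz; have cu' := mu'.2 _ cz; have cv := mvu'.2 _ cz.
  have [_ _ Fv] := iv.
  have := uu' z cz; rewrite /=.
  (* In either class [F \o u] depends on its argument only through [F], so [v] drops out of
     [u \o v \o u']. *)
  have [[_ _ Fu]|uE] := invariants_cases iu.
    by move=> e; rewrite Fu // Fv // -(Fu _ cu') e.
  have E y : circle y -> F (u y) = s (F y) by move=> cy; exact: uE.
  by move=> e; rewrite E // Fv // -E // e.
- have [h ih hE] := invariants_swap_exists lF.
  exists h; split => // [iFh|u iu]; first exact: swap_not_invariant iFh hE.
  have [Fu|uE] := invariants_cases iu; [by left|right].
  have [h' [ih' hh' h'h]] := invariants_invertible_step invF ih.
  have mh' := invariants_map ih'; have mu := invariants_map iu.
  exists (h' \o u); split; last first.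
    by move=> z cz; rewrite /= [h (h' _)]hh' //; exact: mu.2.
  have [ch'u Th'u] := circle_map_comp mh' mu.
  (* If [h'] preserved [F], so would its inverse [h]. Hence [h'] and [u] both induce [s], and
     [h' \o u] preserves [F]. *)
  split => // z cz; have [[_ _ Fh']|h'E] := invariants_cases ih'.
    case: (swap_not_invariant (u := h) _ hE); case: ih => ch Th _.
    split => // y cy; rewrite -(Fh' _ (Th _ cy)).
    by rewrite [h' (h y)]h'h.
  exact: (invariants_swap_comp mu h'E uE cz).
Qed.

Lemma generates_square g : lifts_rootable F ->
  generates (G \o F) g -> generates F (g \o g).
Proof.
move=> lF [ig gen].
have mg := invariants_map ig.
have [h ih hE] := invariants_swap_exists lF.
have mh := invariants_map ih.
(* Otherwise all powers of [g] would preserve [F], and so would the lift [h] of [s], whether it is a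
   power or the inverse of one. *)
have gE : eqT (F \o g) (s \o F).
  have [iFg|//] := invariants_cases ig.
  case: (swap_not_invariant (u := h) _ hE); case: (ih) => ch Th _.
  split => // z cz; have [m] := gen h ih.
  have [_ _ Fm] := invariants_gpow m iFg.
  by case=> E; [rewrite E ?Fm|rewrite -(Fm _ (Th _ cz)) [gpow g m _]E].
have igg : invariants F (g \o g).
  have [cgg Tgg] := circle_map_comp mg mg.
  by split=> // z cz; exact: (invariants_swap_comp mg gE gE cz).
have gpow2 m : gpow g m.*2 = gpow (g \o g) m.
  apply/funext => z; rewrite /gpow; elim: m => //= m IH.
  by rewrite IH.
have odd_gpow m : odd m -> eqT (F \o gpow g m) (s \o F).
  move=> om z cz; rewrite -(odd_double_half m) om add1n /= gpow2.
  have [_ Tm Fm] := invariants_gpow m./2 igg.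
  by rewrite [F (g _)](gE _ (Tm _ cz)) /= Fm.
split => // u iu; have [m mE] := gen u (invariants_sub iu).
(* An odd power of [g] induces [s], which has no fixed point, whereas [u] preserves [F]; so the
   exponent is even. *)
have [om|em] := boolP (odd m).
  have [_ _ sN _ _] := Gs; exfalso.
  have Ems := odd_gpow m om.
  have [_ Tu Fu] := iu.
  have cF := mF.2 _ circle1.
  apply: (sN _ cF); case: mE => E.
    by rewrite -[LHS](Ems _ circle1) /= -(E _ circle1) Fu //; exact: circle1.
  have := Ems _ (Tu _ circle1); rewrite /= [gpow g m _](E _ circle1) /= Fu //.
  exact: circle1.
exists m./2; rewrite -gpow2.
by rewrite -(odd_double_half m) (negbTE em) add0n in mE.
Qed.

End DoubleStep.

(** * Induction along the chain of compositions *)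

Section Chain.
Variables (n : nat) (Cs : nat -> C -> C).
Hypothesis sqC : forall j, (1 <= j <= n)%N -> squaring_like (Cs j).

Lemma comp_upto_map j : (j <= n)%N -> circle_map (comp_upto Cs j).
Proof.
elim: j => [|j IH] jn /=; first exact: circle_map_id.
by apply: circle_map_comp (IH (ltnW jn)); apply/squaring_like_map/sqC.
Qed.

(** The index [k + j] budgets one square root for each of the [j] factors, spent from the outermost
    factor inwards. *)
Lemma comp_upto_lift j k s : (j <= n)%N -> rootable (k + j) s ->
  exists2 s', rootable k s' & eqT (comp_upto Cs j \o s') (s \o comp_upto Cs j).
Proof.
elim: j s => [|j IH] s jn /=; first by rewrite addn0 => rs; exists s.
rewrite addnS => rs.
have [t rt tE] : exists2 t, rootable (k + j) t & eqT (Cs j.+1 \o t) (s \o Cs j.+1).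
  by apply: squaring_like_lift rs; exact: sqC.
have [s' rs' s'E] := IH _ (ltnW jn) rt.
exists s' => // z cz; have cF := (comp_upto_map (ltnW jn)).2 _ cz.
by rewrite /= [comp_upto Cs j (s' z)]s'E //; exact: tE.
Qed.

Lemma comp_upto_lifts j : (j <= n)%N -> lifts_rootable (comp_upto Cs j).
Proof.
move=> jn s rs; have [s' rs' sE] := comp_upto_lift (k := 0) jn (rs _).
by exists s' => //; exact: rootable_map rs'.
Qed.

Lemma comp_upto_invertible j :
  (j <= n)%N -> invariants_invertible (comp_upto Cs j).
Proof.
elim: j => [|j IH] jn /=.
  move=> u [_ _ uE]; exists id; split => //.
  by split => //; exact: cts_circle_id.
have [s hs] := squaring_like_deck (sqC (jn : 1 <= j.+1 <= n)%N).
exact: invariants_invertible_step (comp_upto_map (ltnW jn)) hs (IH (ltnW jn)).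
Qed.

Lemma comp_upto_normal_index2 j : (j < n)%N ->
  normal_index2 (invariants (comp_upto Cs j)) (invariants (comp_upto Cs j.+1)).
Proof.
move=> jn; have [s hs] := squaring_like_deck (sqC (jn : 1 <= j.+1 <= n)%N).
have jn' := ltnW jn.
exact: invariants_normal_index2 (comp_upto_map jn') hs (comp_upto_lifts jn')
  (comp_upto_invertible jn').
Qed.

(** Each squaring of the generator strips the outermost remaining factor. *)
Lemma generates_gpow g i : (i <= n)%N -> generates (comp_upto Cs n) g ->
  generates (comp_upto Cs (n - i)) (gpow g (2 ^ i)).
Proof.
move=> + gen; elim: i => [|i IH] jn; first by rewrite subn0.
have := IH (ltnW jn); rewrite -(subnSK jn).
have jn' : (n - i.+1 < n)%N by rewrite subnSK // leq_subr.
have -> : gpow g (2 ^ i.+1) = gpow g (2 ^ i) \o gpow g (2 ^ i).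
  by apply/funext => z; rewrite /gpow expnS mul2n -addnn iterD.
have [s hs] := squaring_like_deck (sqC (jn' : 1 <= (n - i.+1).+1 <= n)%N).
exact (generates_square (comp_upto_map (ltnW jn')) hs
  (comp_upto_lifts (ltnW jn'))).
Qed.

End Chain.

(** * The innermost factor and its generator *)

Lemma eqT_invariants F F' u : eqT F F' -> invariants F u -> invariants F' u.
Proof.
by move=> E [cu Tu Fu]; split => // z cz; rewrite -!E // ?Fu //; exact: Tu.
Qed.

Lemma eqT_generates F F' g : eqT F F' -> generates F g -> generates F' g.
Proof.
move=> E [ig gen]; split; first exact: eqT_invariants ig.
move=> u iu; apply: gen; apply: eqT_invariants iu.
by move=> z cz; rewrite E.
Qed.

Lemma phi_not_id a : ~ eqT (phi a) id.
Proof.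
move=> E.
have cN1 : circle (-1 : C) := circleN circle1.
(* Were the denominator zero, the convention [0^-1 = 0] would give [phi a z = 0], which is not
   [z]. *)
have fixden z : circle z -> 1 - conj a * z != 0.
  move=> cz; apply/negP => /eqP d0; have := E z cz; rewrite /phi d0 invr0 mulr0.
  by move=> /= /esym/eqP; rewrite (negbTE (circle_neq0 cz)).
have fixE z : circle z -> a - z = z * (1 - conj a * z).
  by move=> cz; rewrite -[X in _ = X * _](E z cz) /phi divfK // fixden.
have e1 := fixE _ circle1; have e2 := fixE _ cN1.
(* Subtracting the fixed point equations at 1 and -1 eliminates both [a] and [conj a]. *)
have : 4 = 0 :> C.
  have -> : 4 = (1 * (1 - conj a * 1) - (a - 1)) - (-1 * (1 - conj a * -1) - (a - -1)) :> C.
    by ring.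
  by rewrite -e1 -e2 !subrr.
by move/eqP; rewrite pnatr_eq0.
Qed.

Lemma generator_eq_phi F s a g : deck_involution F s -> `|a| < 1 ->
  eqT F (fun z => z * phi a z) -> generates F g -> eqT g (phi a).
Proof.
move=> dF a1 FE [ig gen].
have [_ _ _ _ F2] := dF.
have mp := phi_circle_map a1.
(* As an involution, [phi a] exchanges the two factors of [z * phi a z]. *)
have ip : invariants F (phi a).
  case: mp => cp Tp; split => // z cz.
  by rewrite !FE ?phiK //; [rewrite mulrC|exact: Tp].
have only u : invariants F u -> eqT u id \/ eqT u (s \o id).
  by move=> iu; apply: F2 (invariants_map iu) circle_map_id _; case: iu.
have ps : eqT (phi a) s by case: (only _ ip) => // /phi_not_id.
case: (only _ ig) => [gid|gs]; last by move=> z cz; rewrite gs // ps.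
(* A trivial generator would have only trivial powers and could not produce [phi a]. *)
have gm m : eqT (gpow g m) id.
  move=> z cz; elim: m => [//|m IH].
  exact: etrans (congr1 g IH) (gid z cz).
have [_ Tp] := mp.
case: (gen _ ip) => m [E|E]; case: (@phi_not_id a) => z cz.
  by rewrite E // gm.
by rewrite -[RHS](E z cz) /= gm //; exact: Tp.
Qed.

End CircleMaps.

Theorem theorem6p2 (R : realType) (n : nat) (B : R[i] -> R[i])
    (Cs : nat -> R[i] -> R[i]) (g : R[i] -> R[i]) :
  (0 < n)%N ->
  is_blaschke (2 ^ n) B ->
  generates B g ->
  (forall j, (1 <= j <= n)%N -> is_blaschke 2 (Cs j)) ->
  (forall z : R[i], `|z| <= 1 -> B z = comp_upto Cs n z) ->
  (forall j, (1 <= j <= n.-1)%N ->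
     normal_index2 (invariants (comp_upto Cs j))
                   (invariants (comp_upto Cs j.+1))) /\
  (forall a : R[i], `|a| < 1 ->
     (forall z, Cs 1%N z = z * ((a - z) / (1 - Num.conj a * z))) ->
     eqT (gpow g (2 ^ n.-1)) (phi a)).
Proof.
move=> n0 _ gen bC BE.
have sqC j (jn : (1 <= j <= n)%N) : squaring_like (Cs j).
  exact: blaschke2_squaring_like (bC j jn).
split=> [j /andP[_ jn]|a a1 C1E].
  by apply: (comp_upto_normal_index2 sqC); rewrite -(prednK n0) ltnS.
have gen_n : generates (comp_upto Cs n) g.
  by apply: eqT_generates gen => z cz; apply: BE; rewrite cz.
have := generates_gpow sqC (leq_pred n) gen_n.
(* After [n.-1] squarings exactly one factor, [Cs 1], is left; this uses [0 < n]. *)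
have -> : (n - n.-1 = 1)%N by rewrite -subn1 subKn.
have [s ds] := squaring_like_deck (sqC 1%N n0).
by apply: (@generator_eq_phi R (Cs 1%N) s a) => // z _; exact: C1E.
Qed.
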